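(* Let $(T,R)$ be a problem instance with $n\ge 1$ unit-weight tasks and $m$ resources with delays $d_1\le\dots\le d_m$. The algorithm FindOptNash, defined as follows, constructs a lowest-cost assignment in $\mathcal{N}(T,R)$ (that is, a Nash assignment whose cost is minimum among all Nash assignments of $(T,R)$) in $O(nm)$ time. FindOptNash$(T,R)$: (1) Set $n_i=0$ for $i=1,\dots,m$. (2) For $\tau=1,\dots,n$: (a) let $K$ be the set of resources $k$ that minimize $(n_k+1)d_k$; (b) choose $k\in K$ so as to minimize $n_k$; (c) increment $n_k$. (3) Return $\overline{n}=\langle n_1,\dots,n_m\rangle$.
   Context: There are $m$ resources with positive real delays $d_1\le\dots\le d_m$ and $n$ tasks, each of weight $1$. An assignment is represented by $\overline{n}=\langle n_1,\dots,n_m\rangle$ with nonnegative integers $n_\ell$ summing to $n$, where $n_\ell$ is the number of tasks assigned to resource $\ell$. Its (social) cost is $C(\overline{n})=\sum_{\ell=1}^m n_\ell^2 d_\ell$. The assignment $\overline{n}$ is a Nash assignment if no task can lower its own load (the load of resource $\ell$ being $n_\ell d_\ell$) by unilaterally moving to another resource; equivalently, $n_i d_i\le (n_j+1)d_j$ for all $i,j$. $\mathcal{N}(T,R)$ denotes the set of Nash assignments. Running time counts elementary arithmetic operations and comparisons. Remaining ties in step (2b) may be broken arbitrarily. *)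

(* Defs.v *)
From HB Require Import structures.
From mathcomp Require Import all_boot all_order all_algebra.
From mathcomp Require Import reals.
Set Implicit Arguments.
Unset Strict Implicit.
Unset Printing Implicit Defensive.
Import Order.TTheory GRing.Theory Num.Theory.
Local Open Scope ring_scope.

Section Game.
Context {R : realType} {m : nat}.
Implicit Types (d : 'I_m -> R) (a : {ffun 'I_m -> nat}).

Definition delays d : Prop :=
  (forall i, 0 < d i) /\ (forall i j : 'I_m, (i <= j)%N -> d i <= d j).

(* [a l] is the number of tasks on resource [l]. *)
Definition assignment (n : nat) a : Prop := (\sum_l a l)%N = n.

Definition load d a (l : 'I_m) : R := (a l)%:R * d l.

Definition cost d a : R := \sum_l (a l)%:R ^+ 2 * d l.

(* Meaningful for [i != j] and [0 < a i]. *)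
Definition move a (i j : 'I_m) : {ffun 'I_m -> nat} :=
  [ffun l => if l == i then (a i).-1 else if l == j then (a j).+1 else a l].

Definition nash d (n : nat) a : Prop :=
  assignment n a /\
  forall i j, (0 < a i)%N -> i != j -> ~ (load d (move a i j) j < load d a i).

Definition lowest_cost_nash d (n : nat) a : Prop :=
  nash d n a /\ forall b, nash d n b -> cost d a <= cost d b.

End Game.

(* A value together with the number of elementary operations spent on it. *)
Record timed (A : Type) := Timed { result : A; ticks : nat }.

Definition ret (A : Type) (x : A) : timed A := Timed x 0.

Definition bind (A B : Type) (c : timed A) (f : A -> timed B) : timed B :=
  let c' := f (result c) in Timed (result c') (ticks c + ticks c')%N.

Notation "'let*' x ':=' c 'in' f" := (bind c (fun x => f))
  (at level 200, x name, c at level 100, f at level 200,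
   format "'let*'  x  ':='  c  'in' '//' f").

(* One elementary operation: used only around a single arithmetic operation,
   comparison, array write, or selection of an element of a list. *)
Definition op (A : Type) (x : A) : timed A := Timed x 1.

(* Loop control is charged too: a bound test and a counter increment per
   iteration, and the final bound test. *)
Fixpoint for_loop (I A : Type) (s : seq I) (body : I -> A -> timed A) (x : A)
    : timed A :=
  if s is i :: s' then
    let* _ := Timed tt 2 in
    let* y := body i x in
    for_loop s' body y
  else op x.

(* The elements of [s] minimizing [key], by a linear scan; the accumulator [K]
   lists the minimizers among the elements seen so far, so comparing with its
   head is enough. *)
Definition argmins (disp : Order.disp_t) (T : orderType disp) (I : Type)
    (key : I -> timed T) (s : seq I) : timed (seq I) :=
  for_loop s (fun k K =>
    if K is j :: _ then
      let* x := key k in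
      let* y := key j in
      let* lt_xy := op (x < y)%O in
      if lt_xy then ret [:: k] else
      let* eq_xy := op (x == y) in
      ret (if eq_xy then k :: K else K)
    else ret [:: k]) [::].

Section FindOptNash.
Context {R : realType} {m : nat}.

(* A way of breaking the remaining ties: it picks one of the candidates, and may
   depend on the iteration, so that every sequence of choices is covered. *)
Definition tie_breaking (tie : nat -> seq 'I_m -> 'I_m) : Prop :=
  forall tau s, s != [::] -> tie tau s \in s.

Variables (d : 'I_m -> R) (tie : nat -> seq 'I_m -> 'I_m).
Implicit Type a : {ffun 'I_m -> nat}.

(* [m] array writes. *)
Definition init : timed {ffun 'I_m -> nat} := Timed [ffun => 0%N] m.

Definition write a (k : 'I_m) (x : nat) : timed {ffun 'I_m -> nat} :=
  op [ffun l => if l == k then x else a l].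

Definition place_task (tau : nat) a : timed {ffun 'I_m -> nat} :=
  let* K := argmins (fun k => let* x := op (a k + 1)%N in op (x%:R * d k))
                    (enum 'I_m) in
  let* K' := argmins (fun k => ret (a k)) K in
  let* k := op (tie tau K') in
  let* x := op (a k + 1)%N in
  write a k x.

Definition FindOptNash (n : nat) : timed {ffun 'I_m -> nat} :=
  let* a := init in
  for_loop (iota 1 n) place_task a.

End FindOptNash.

(* Main.v *)
Require Import Defs.
From mathcomp Require Import all_boot all_order all_algebra.
From mathcomp Require Import reals.
From mathcomp Require Import zify lra.
Set Implicit Arguments.
Unset Strict Implicit.
Unset Printing Implicit Defensive.
Import Order.TTheory GRing.Theory Num.Theory.
Local Open Scope ring_scope.

(** Any two Nash assignments [a], [b] of the same number of tasks differ by at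
    most one task per resource, and wherever they differ the larger of the two
    loads is one common value [w].  Adding the [c]-th task to resource [l] costs
    [(2 c - 1) d l = 2 (c d l) - d l], so that on these resources only the delays
    matter: [a] is optimal as soon as moving a task in [a] between two tied
    resources never goes to a slower one.  Both this property and the Nash
    property are invariants of the greedy loop, since among the tied candidates
    of load [w] the one with fewest tasks is the slowest. *)

(** [P] depends on the prefix already processed, so an invariant can refer to the elements scanned
    or the number of tasks placed. Loop control adds 2 per iteration and 1 at the end. *)
Lemma for_loop_inv (I A : Type) (P : seq I -> A -> Prop) (c : nat)
    (body : I -> A -> timed A) (s : seq I) (x : A) :
  (forall pre i y, P pre y ->
     P (rcons pre i) (result (body i y)) /\ (ticks (body i y) <= c)%N) ->
  P [::] x ->
  P s (result (for_loop s body x)) /\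
  (ticks (for_loop s body x) <= size s * (c + 2) + 1)%N.
Proof.
move=> bodyP; suff gen pre : P pre x -> P (pre ++ s) (result (for_loop s body x))
    /\ (ticks (for_loop s body x) <= size s * (c + 2) + 1)%N by apply: gen.
elim: s pre x => [|i s IHs] pre x Px; first by rewrite cats0.
have [Py cy] := bodyP _ i _ Px; rewrite -cat_rcons.
by have [Ps cs] := IHs _ _ Py; split=> //=; lia.
Qed.

(** The size clause bounds the cost of a second scan run on [K]; the emptiness clause lets [tie] be
    applied to its outcome. *)
Definition argminsOf (disp : Order.disp_t) (T : orderType disp) (I : eqType)
    (f : I -> T) (s K : seq I) : Prop :=
  [/\ (size K <= size s)%N, (K == [::]) = (s == [::]) &
      forall k, k \in K <-> k \in s /\ forall j, j \in s -> (f k <= f j)%O].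

Lemma argminsP (disp : Order.disp_t) (T : orderType disp) (I : eqType)
    (key : I -> timed T) (c : nat) (s : seq I) :
  (forall k, ticks (key k) = c) ->
  argminsOf (fun k => result (key k)) s (result (argmins key s)) /\
  (ticks (argmins key s) <= size s * (2 * c + 4) + 1)%N.
Proof.
move=> keyc; set f := fun k => result (key k).
(* The body makes two key evaluations and two comparisons; the other 2 is loop control. *)
rewrite [(2 * c + 4)%N](_ : _ = 2 * c + 2 + 2)%N; last by lia.
apply: (for_loop_inv (P := argminsOf f)) => [pre k K|]; last first.
  by split=> // k; split=> [|[]].
have rcons_nil (x : seq I) y : (rcons x y == [::]) = false by case: x.
case: K => [|j K] [sz nil_eq memK].
  move/esym/eqP: nil_eq => ->; split=> //; split=> // y.
  rewrite /= mem_seq1; split=> [/eqP->|[]//].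
  by split=> [|z]; rewrite ?eqxx ?mem_seq1 // => /eqP->.
have [jpre jmin] := (memK j).1 (mem_head _ _).
split; last by rewrite /= !keyc; case: ifP => _ /=; lia.
rewrite /= -!/(f _); case: (ltgtP (f k) (f j)) => [lt_kj|lt_jk|eq_kj] /=.
- split=> [||y]; rewrite ?size_rcons ?rcons_nil //.
  rewrite inE; split=> [/eqP->|[]].
    split=> [|z]; rewrite mem_rcons inE ?eqxx // => /predU1P[->//|/jmin].
    by apply: le_trans (ltW _).
  rewrite mem_rcons inE => /predU1P[->//|/jmin le_jy /(_ k)].
  rewrite mem_rcons mem_head => /(_ isT) le_yk.
  by have := lt_le_trans lt_kj (le_trans le_jy le_yk); rewrite ltxx.
- split=> [||y]; rewrite ?size_rcons ?rcons_nil //; first exact: leqW.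
  split=> [/memK[ypre ymin]|[]].
    split=> [|z]; rewrite mem_rcons inE ?ypre ?orbT // => /predU1P[->|/ymin//].
    exact: le_trans (ymin _ jpre) (ltW lt_jk).
  rewrite mem_rcons inE => /predU1P[->|ypre] ymin.
    have := ymin j; rewrite mem_rcons inE jpre orbT => /(_ isT).
    by rewrite leNgt lt_jk.
  apply/memK; split=> // z zpre; apply: ymin.
  by rewrite mem_rcons inE zpre orbT.
- split=> [||y]; rewrite ?size_rcons ?rcons_nil //.
  rewrite inE; split=> [/predU1P[->|/memK[ypre ymin]]|[]].
  + split=> [|z]; rewrite mem_rcons inE ?eqxx // => /predU1P[->//|/jmin].
    by rewrite eq_kj.
  + split=> [|z]; rewrite mem_rcons inE ?ypre ?orbT // => /predU1P[->|/ymin//].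
    by rewrite eq_kj ymin.
  rewrite mem_rcons inE => /predU1P[->|ypre] ymin; first by rewrite eqxx.
  apply/orP; right; apply/memK; split=> // z zpre; apply: ymin.
  by rewrite mem_rcons inE zpre orbT.
Qed.

Section Nash.
Context {R : realType} {m : nat} (d : 'I_m -> R).
Hypothesis d_gt0 : forall i, 0 < d i.
Implicit Types a b : {ffun 'I_m -> nat}.

Definition stable a : Prop := forall i j, (a i)%:R * d i <= (a j).+1%:R * d j.

(** Moving a task from [i] to [j] across such a tie changes the cost by [d i - d j]. *)
Definition tie_optimal a : Prop :=
  forall i j, (a i)%:R * d i = (a j).+1%:R * d j -> d j <= d i.

(** The cases that [stable] adds are free: an empty resource has load 0, and for [i = j] one more
    task only raises the load. *)
Lemma nashP n a : nash d n a <-> assignment n a /\ stable a.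
Proof.
split=> -[an st]; split=> // i j; last first.
  move=> ai ij; apply/negP; rewrite -leNgt /load ffunE eq_sym (negPf ij) eqxx.
  exact: st.
have [-> | ai] := posnP (a i); first by rewrite mul0r mulr_ge0 // ltW.
have [<- | ij] := eqVneq i j; first by rewrite ler_wpM2r ?ler_nat // ltW.
move/negP: (st i j ai ij); rewrite -leNgt /load ffunE eq_sym (negPf ij) eqxx.
by [].
Qed.

(** The inequalities close a cycle, [a i * d i <= (a j + 1) * d j <= b j * d j <= (b i + 1) * d i <=
    a i * d i], so all are equalities, and the positive delays cancel. *)
Lemma stable_exchange a b i j :
  stable a -> stable b -> (b i < a i)%N -> (a j < b j)%N ->
  [/\ a i = (b i).+1, b j = (a j).+1 & (a i)%:R * d i = (b j)%:R * d j].
Proof.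
move=> sta stb ltbi ltaj.
have leM (x y : nat) l : (x <= y)%N -> x%:R * d l <= y%:R * d l.
  by move=> le_xy; rewrite ler_wpM2r ?ler_nat // ltW.
have M_inj (x y : nat) l : x%:R * d l = y%:R * d l -> x = y.
  by move/(mulIf (lt0r_neq0 (d_gt0 l)))/eqP; rewrite eqr_nat => /eqP.
have h1 := sta i j; have h2 := leM _ _ j ltaj.
have h3 := stb j i; have h4 := leM _ _ i ltbi.
by split; [apply: (M_inj _ _ i) | apply: (M_inj _ _ j) |]; lra.
Qed.

Lemma exists_lt_of_sum_eq a b l :
  (\sum_i a i = \sum_i b i)%N -> (a l < b l)%N -> exists i, (b i < a i)%N.
Proof.
move=> eq_ab ltl; apply/existsP; apply: contraTT isT => /existsPn le_ab.
have: (\sum_i a i < \sum_i b i)%N; last by rewrite eq_ab ltnn.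
rewrite (bigD1 l) //= [ltnRHS](bigD1 l) //= -addSn leq_add //.
by apply: leq_sum => i _; rewrite leqNgt le_ab.
Qed.

Lemma tie_optimal_cost_le n a b :
  assignment n a -> stable a -> tie_optimal a ->
  assignment n b -> stable b -> cost d a <= cost d b.
Proof.
move=> an sta topt bn stb; have eq_ab := etrans an (esym bn).
have [/existsP[i0 lt0]|/existsPn le_ab] :=
  boolP [exists i, (b i < a i)%N]; last first.
  rewrite /cost (_ : a = b) //; apply/ffunP => i; apply/eqP.
  rewrite eqn_leq leqNgt le_ab /= leqNgt; apply/negP => lti.
  by have [j] := exists_lt_of_sum_eq eq_ab lti; apply/negP.
have [j0 ltj0] := exists_lt_of_sum_eq (esym eq_ab) lt0.
(* With [w] the common load, the fastest surplus resource [l] has the largest marginal cost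
   [2 w - d l] among the surplus resources; by tie optimality every deficit resource charges at
   least as much. *)
case: (arg_minP d (P := fun i => (b i < a i)%N) lt0) => l ltl lmin.
(* [mu] is a Lagrange multiplier for the constraint on the number of tasks. *)
set mu := 2 * ((a l)%:R * d l) - d l.
have key i : (a i)%:R ^+ 2 * d i - (b i)%:R ^+ 2 * d i
             <= ((a i)%:R - (b i)%:R) * mu.
  have [lti|lti|->] := ltngtP (a i) (b i); last by rewrite !subrr mul0r.
    have [_ bi eqw] := stable_exchange sta stb ltl lti.
    have := topt l i; rewrite -bi => /(_ eqw).
    by move: eqw; rewrite /mu bi -natr1 => ->; nra.
  (* Both [i] and [l] are in surplus, so their loads are compared through the deficit resource
     [j0]. *)
  have [ai _ eqi] := stable_exchange sta stb lti ltj0.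
  have [_ _ eql] := stable_exchange sta stb ltl ltj0.
  have := lmin i lti; move: eqi; rewrite -eql /mu => <-.
  by rewrite ai -natr1; nra.
rewrite -subr_le0 /cost -sumrB (le_trans (ler_sum _ (fun i _ => key i))) //.
by rewrite -mulr_suml sumrB -!natr_sum eq_ab subrr mul0r.
Qed.

Variable tie : nat -> seq 'I_m -> 'I_m.
Hypothesis tieP : tie_breaking tie.

Definition greedy_inv (n : nat) a : Prop :=
  [/\ assignment n a, stable a & tie_optimal a].

Definition increment a k : {ffun 'I_m -> nat} :=
  [ffun l => if l == k then (a k + 1)%N else a l].

Lemma place_taskP tau a : (0 < m)%N ->
  exists k,
    [/\ result (place_task d tie tau a) = increment a k,
        forall j, (a k).+1%:R * d k <= (a j).+1%:R * d j,
        forall j, (a k).+1%:R * d k = (a j).+1%:R * d j -> (a k <= a j)%N &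
        (ticks (place_task d tie tau a) <= 17 * m)%N].
Proof.
move=> m_gt0; rewrite /place_task /=.
set key1 := fun k : 'I_m => let* x := op (a k + 1)%N in op (x%:R * d k).
have keyE j : result (key1 j) = (a j).+1%:R * d j by rewrite /= addn1.
have [//|] := argminsP (key := key1) (c := 2) (enum 'I_m).
set K := argmins key1 _ => -[sK nilK memK] tK.
have [//|] := argminsP (key := fun k : 'I_m => ret (a k)) (c := 0) (result K).
set K' := argmins _ _ => -[sK' nilK' memK'] tK'.
have K'0 : result K' != [::].
  by rewrite nilK' nilK -size_eq0 size_enum_ord -lt0n.
have /memK'[/memK[_ kmin] kmin'] := tieP tau K'0.
exists (tie tau (result K')); split=> // [j|j eqj|].
- by rewrite -!keyE; apply: kmin; rewrite mem_enum.
- apply: kmin'; apply/memK; split=> [|i _]; first by rewrite mem_enum.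
  by rewrite keyE -eqj -keyE; apply: kmin; rewrite mem_enum.
(* The scans cost at most [8 m + 1] and [4 m + 1], and 3 operations remain; [12 m + 5 <= 17 m] since
   [m] is positive. *)
- by move: tK tK' sK; rewrite size_enum_ord /=; lia.
Qed.

(** Stability survives because the only load that rises is that of [k], and its new value is the
    least that any placement could give. *)
Lemma greedy_inv_increment n a k :
  (forall j, (a k).+1%:R * d k <= (a j).+1%:R * d j) ->
  (forall j, (a k).+1%:R * d k = (a j).+1%:R * d j -> (a k <= a j)%N) ->
  greedy_inv n a -> greedy_inv n.+1 (increment a k).
Proof.
move=> kmin kmin' [an sta topt].
have le_inc j : (a j).+1%:R * d j <= (increment a k j).+1%:R * d j.
  rewrite ler_wpM2r ?ler_nat ?(ltW (d_gt0 _)) //.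
  by rewrite ffunE; case: eqP => [->|//]; rewrite addn1.
split=> [|i j|i j].
- rewrite /assignment (bigD1 k) //= ffunE eqxx -an [in RHS](bigD1 k) //=.
  rewrite addn1 addSn; congr (_ + _).+1.
  by apply: eq_bigr => i /negPf ik; rewrite ffunE ik.
- apply: le_trans (le_inc j); rewrite ffunE; case: eqP => [->|_] //.
  by rewrite addn1.
- have [<- //|ij] := eqVneq i j.
  rewrite !ffunE; case: (eqVneq i k) => [eqi|nik].
    subst i; rewrite eq_sym (negPf ij) addn1 => eqj.
    (* [j] was also a candidate, with at least as many tasks as [k] and the same resulting load, so
       it cannot be slower. *)
    have := kmin' _ eqj; rewrite -(ler_nat R) => le_kj.
    have dk := d_gt0 k; have dj := d_gt0 j; have ak := ler0n R (a k).
    by move: eqj; rewrite -!natr1 => eqj; rewrite leNgt; apply/negP; nra.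
  case: (eqVneq j k) => [->|_]; last exact: topt.
  (* No tie can occur here: it would need [a i * d i = (a k + 2) * d k], above the stable bound
     [(a k + 1) * d k]. *)
  have := sta i k; have := d_gt0 k; rewrite addn1 -natr1 => dk le_ik eq_ik.
  by exfalso; lra.
Qed.

Lemma greedy_inv0 : greedy_inv 0 [ffun => 0%N].
Proof.
split=> [|i j|i j].
- by rewrite /assignment big1 // => i; rewrite ffunE.
- by rewrite !ffunE mul0r mul1r ltW.
- by rewrite !ffunE mul0r mul1r => dj; have := d_gt0 j; rewrite -dj ltxx.
Qed.

Lemma FindOptNashP n : (0 < m)%N ->
  greedy_inv n (result (FindOptNash d tie n)) /\
  (ticks (FindOptNash d tie n) <= m + (n * (17 * m + 2) + 1))%N.
Proof.
move=> m_gt0.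
have [pre tau a inv_a||] := for_loop_inv (P := fun pre => greedy_inv (size pre))
  (c := 17 * m) (body := place_task d tie) (iota 1 n) (x := [ffun => 0%N]).
- have [k [-> kmin kmin' tk]] := place_taskP tau a m_gt0.
  by rewrite size_rcons; split=> //; apply: greedy_inv_increment.
- exact: greedy_inv0.
- by rewrite size_iota leq_add2l.
Qed.

End Nash.

Theorem theorem4p5 (R : realType) :
  exists C : nat,
    forall (m n : nat) (d : 'I_m -> R) (tie : nat -> seq 'I_m -> 'I_m),
      (1 <= m)%N -> (1 <= n)%N -> delays d -> tie_breaking tie ->
      lowest_cost_nash d n (result (FindOptNash d tie n)) /\
      (ticks (FindOptNash d tie n) <= C * (n * m))%N.
Proof.
(* Each of [m], [n] and 1 is at most [n * m], so the bound [m + n * (17 * m + 2) + 1] gives 1 + 17 +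
   2 + 1. *)
exists 21 => m n d tie m_gt0 n_gt0 [d_gt0 _] tieP.
have [[an sta topt] tn] := FindOptNashP d_gt0 tieP n m_gt0.
split; last by apply: leq_trans tn _; nia.
split=> [|b /(nashP d_gt0)[bn stb]]; first by apply/(nashP d_gt0).
exact: (tie_optimal_cost_le d_gt0 an).
Qed.
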